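(* Let $m,n\in\mathbb{N}$, $0<\gamma<mn$, let $\vec p=(p_1,\dots,p_m)$ with $1\le p_i\le\infty$ be a vector of exponents, let $1/p=\sum_{i=1}^m1/p_i$ and $\delta=\gamma-n/p$. Let $\vec v=(v_1,\dots,v_m)$ be an $m$-tuple of weights on $\mathbb{R}^n$. If $\vec v\in\mathcal{H}_m(\vec p,\gamma,\delta)$ and $\alpha=p/(mp-1)>1$, then $\prod_{i=1}^m v_i^{-1}\in\mathrm{RH}_\alpha$.
   Context: A weight is a positive (a.e.) locally integrable function on $\mathbb{R}^n$. $\vec v\in\mathcal{H}_m(\vec p,\gamma,\delta)$ means that the pair $(w,\vec v)$ with $w=\prod_{i=1}^m v_i$ (a weight with $w^{-1}$ locally integrable) is in the class $\mathcal{H}_m(\vec p,\gamma,\delta)$, i.e.: for some numbers $\gamma_1,\dots,\gamma_m$ with $0<\gamma_i<n$ and $\sum_{i=1}^m\gamma_i=\gamma$, there is $C>0$ such that for every ball $B\subset\mathbb{R}^n$ with center $x_B$ $$|B|^{(1-\delta)/n}\prod_{i=1}^m\left(\int_{\mathbb{R}^n}\frac{v_i^{-p_i'}(y)}{(|B|^{1/n}+|x_B-y|)^{(n-\gamma_i+1/m)p_i'}}\,dy\right)^{1/p_i'}\le\frac{C}{|B|}\int_B\prod_{i=1}^m v_i^{-1},$$ where for each $i$ with $p_i=1$ the $i$-th factor is understood as $\left\|\frac{v_i^{-1}}{(|B|^{1/n}+|x_B-\cdot|)^{n-\gamma_i+1/m}}\right\|_\infty$. Here $p_i'$ is the conjugate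 exponent of $p_i$ ($p_i'=1$ if $p_i=\infty$), $n/p=0$ if $p=\infty$, and $p/(mp-1)$ is read as $1/m$ if $p=\infty$. Reverse Hölder classes: for $1<s<\infty$, a weight $u$ is in $\mathrm{RH}_s$ if there is $C>0$ with $\left(\frac1{|B|}\int_B u^s\right)^{1/s}\le \frac{C}{|B|}\int_B u$ for every ball $B\subset\mathbb{R}^n$. *)

(* Defs.v *)
From HB Require Import structures.
From mathcomp Require Import all_boot all_order all_algebra.
From mathcomp Require Import all_classical all_reals all_analysis.

Set Implicit Arguments.
Unset Strict Implicit.
Unset Printing Implicit Defensive.
Import Order.TTheory GRing.Theory Num.Theory.
Import numFieldNormedType.Exports.

Local Open Scope classical_set_scope.
Local Open Scope ring_scope.

(** * Lebesgue measure on R^n *)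

(* On Borel sets, it is built by induction on n from the isomorphism
   R * R^n -> R^(n+1) and the product measure. *)
Section cons_measure.
Context {R : realType} {n : nat}.
Local Notation RT := (measurableTypeR R).

Definition cons_pair (z : RT * n.-tuple RT) : n.+1.-tuple RT :=
  [tuple of z.1 :: z.2].

Lemma measurable_cons_pair : measurable_fun [set: RT * n.-tuple RT] cons_pair.
Proof. exact: measurable_cons. Qed.

Variable mu : {measure set (n.-tuple RT) -> \bar R}.

Definition cons_measure : set (n.+1.-tuple RT) -> \bar R :=
  pushforward (@lebesgue_measure R \x^ mu)%E cons_pair.

Let measurable_preimage_cons A :
  measurable A -> measurable (cons_pair @^-1` A).
Proof.
by move=> mA; rewrite -[X in measurable X]setTI; exact: measurable_cons_pair.
Qed.

Let cons_measure0 : cons_measure set0 = 0%E.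
Proof. by rewrite /cons_measure /pushforward preimage_set0 measure0. Qed.

Let cons_measure_ge0 A : (0 <= cons_measure A)%E.
Proof. by rewrite /cons_measure /pushforward; apply: measure_ge0. Qed.

Let cons_measure_sigma_additive : semi_sigma_additive cons_measure.
Proof.
move=> F mF tF mUF; rewrite /cons_measure /pushforward preimage_bigcup.
apply: measure_semi_sigma_additive.
- by move=> i; exact: measurable_preimage_cons.
- apply/trivIsetP => /= i j _ _ ij; rewrite -preimage_setI.
  by move/trivIsetP : tF => /(_ _ _ _ _ ij) ->//; rewrite preimage_set0.
- by rewrite -preimage_bigcup; exact: measurable_preimage_cons.
Qed.

HB.instance Definition _ := isMeasure.Build _ _ _ cons_measure
  cons_measure0 cons_measure_ge0 cons_measure_sigma_additive.

End cons_measure.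

Fixpoint borel_lebesgue (R : realType) (n : nat) :
    {measure set (n.-tuple (measurableTypeR R)) -> \bar R} :=
  match n with
  | 0 => dirac [tuple]
  | n'.+1 => cons_measure (borel_lebesgue R n')
  end.

(* The Caratheodory completion provides the Lebesgue-measurable sets, so that
   weights below are Lebesgue (not only Borel) measurable functions.  The
   underlying type is convertible to [n.-tuple R]. *)
Definition Rn (R : realType) (n : nat) :=
  caratheodory_type (mu_ext (borel_lebesgue R n)).

Definition leb (R : realType) (n : nat) : {measure set (Rn R n) -> \bar R} :=
  @completed_measure_extension _ _ _ (borel_lebesgue R n).

(** * Euclidean balls *)

Section balls.
Context {R : realType} {n : nat}.
Implicit Types x y : Rn R n.

Definition eucl_dist x y : R :=
  Num.sqrt (\sum_(i < n) (tnth x i - tnth y i) ^+ 2).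

Definition eball x (r : R) : set (Rn R n) := [set y | eucl_dist x y < r].

Definition vol (B : set (Rn R n)) : R := fine (leb R n B).

End balls.

(** * Weights *)

Section weights.
Context {R : realType} {n : nat}.
Implicit Types (u f : Rn R n -> R) (B : set (Rn R n)).

Definition loc_integrable f :=
  measurable_fun [set: Rn R n] f /\
  forall (x : Rn R n) (r : R),
    (\int[leb R n]_(y in eball x r) `|f y|%:E < +oo)%E.

Definition weight u :=
  loc_integrable u /\ {ae leb R n, forall y, 0 < u y}.

Definition average B f : \bar R :=
  ((vol B)^-1%:E * \int[leb R n]_(y in B) (f y)%:E)%E.

Definition reverse_hoelder (s : R) u :=
  weight u /\
  exists2 C : R, 0 < C &
    forall (x : Rn R n) (r : R), 0 < r ->
      let B := eball x r in
      (average B (fun y => u y `^ s)%R `^ s^-1 <= C%:E * average B u)%E.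

End weights.

(** * The classes H_m(p, gamma, delta) *)

Section Hclass.
Context {R : realType} {n : nat}.
Implicit Types (x : Rn R n) (r : R).

(* With p' the exponent conjugate to p, this is the norm in L^(p') of
   v^-1 / (|B|^(1/n) + |x_B - .|)^k, where B = B(x, r). *)
Definition Hfactor (p : \bar R) (k : R) (v : Rn R n -> R) x r : \bar R :=
  let q := fine (hoelder_conjugate p) in
  let base y := vol (eball x r) `^ n%:R^-1 + eucl_dist x y in
  if p == 1%E then
    Lnorm (leb R n) +oo%E (fun y => ((v y)^-1 / base y `^ k)%:E)
  else
    ((\int[leb R n]_y (v y `^ (- q) / base y `^ (k * q))%:E) `^ q^-1)%E.

Definition Hclass (m : nat) (p : 'I_m -> \bar R) (gamma delta : R)
    (v : 'I_m -> Rn R n -> R) :=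
  [/\ weight (fun y => \prod_(i < m) v i y),
      loc_integrable (fun y => (\prod_(i < m) v i y)^-1) &
      exists g : 'I_m -> R,
        [/\ forall i, 0 < g i < n%:R,
            \sum_(i < m) g i = gamma &
            exists2 C : R, 0 < C &
              forall x r, 0 < r ->
                let B := eball x r in
                ((vol B `^ ((1 - delta) / n%:R))%:E *
                 \prod_(i < m) Hfactor (p i) (n%:R - g i + m%:R^-1) (v i) x r
                 <= C%:E * average B (fun y => \prod_(i < m) (v i y)^-1)%R)%E]].

End Hclass.

(* The exponent p / (m p - 1), read as 1 / m for p = +oo.  For p = 1 / m (all
   p_i equal to 1) it is not a finite exponent, and the value here is
   (1 / m) / 0 = 0. *)
Definition rh_exponent {R : realType} (m : nat) (p : \bar R) : R :=
  if p is r%:E then r / (m%:R * r - 1) else m%:R^-1.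

(* Main.v *)
Require Import Defs.
From HB Require Import structures.
From mathcomp Require Import all_boot all_order all_algebra.
From mathcomp Require Import all_classical all_reals all_analysis.
From mathcomp Require Import measurable_realfun ess_sup_inf.
From mathcomp Require Import ring lra.
Import Order.TTheory GRing.Theory Num.Theory.
Import numFieldNormedType.Exports.
Local Open Scope classical_set_scope.
Local Open Scope ring_scope.

(** Write [1 / p_i'] for [1 - 1 / p_i] and [u] for the product of the
    [v_i^-1].  Since [1 / alpha = m - 1 / p] is the sum of the [1 / p_i'],
    Hoelder's inequality for [m] functions bounds the [L^alpha] norm of a
    product by the product of the [L^(p_i')] norms of its factors, where some
    [p_i'] may be infinite.

    It is applied to the functions [v_i^-1 / b^(k_i)], with
    [b(y) = |B|^(1/n) + |x_B - y|] and [k_i = n - gamma_i + 1/m]; their norms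
    are exactly the factors in the definition of H_m.  On the ball [B] itself,
    [|x_B - y|] is at most the radius, hence at most a constant times
    [|B|^(1/n)] ([radius_le_vol]), so that [u] is bounded on [B] by
    [C |B|^(K/n)] times the product of these functions, where
    [K = sum k_i = m n - gamma + 1].  Therefore ([local_hoelder],
    [average_prodV_le]) the [alpha]-average of [u] over [B] is at most
    [C |B|^(K/n - 1/alpha)] times the product of the H_m factors.

    The exponent [K/n - 1/alpha] equals [(1 - delta)/n] because
    [delta = gamma - n/p].  So the right-hand side is the left-hand side of
    the H_m condition, which is bounded by the average of [u]: this is the
    reverse Hoelder inequality. *)

(** * Hoelder's inequality for several functions *)

Section hoelder_products.
Set Implicit Arguments.
Unset Strict Implicit.
Context d (T : measurableType d) (R : realType) (mu : {measure set T -> \bar R}).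
Implicit Types (f g : T -> R) (s t : R).

(** This holds also when [mu] is the zero measure, where the norm is set to 0,
    because then every property holds almost everywhere; with [Lnormy_le] it
    spares the case distinction in the definition of the norm. *)
Lemma Lnormy_ae_ge f :
  {ae mu, forall x, (`|f x|%:E <= Lnorm mu +oo (EFin \o f))%E}.
Proof.
rewrite unlock /=; case: ifPn => [_|].
  exact: (@ess_sup_ge _ T R mu (abse \o (EFin \o f))).
rewrite -leNgt => mu0; exists [set: T]; split => //.
by apply/eqP; rewrite eq_le mu0 measure_ge0.
Qed.

Lemma Lnormy_le f (M : \bar R) :
  (0 <= M)%E -> {ae mu, forall x, (`|f x|%:E <= M)%E} ->
  (Lnorm mu +oo (EFin \o f) <= M)%E.
Proof.
by move=> M0 fM; rewrite unlock /=; case: ifPn => // _; apply/ess_supP.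
Qed.

(** The endpoint case: a bounded factor comes out of the norm.  The exponent of
    a norm is written as the inverse of a real [t >= 0], so that [t = 0] gives
    the essential supremum, and Hoelder's relation between exponents is
    additive in [t] without exceptions at infinity. *)
Lemma hoelder_Lnormy t f g :
  measurable_fun [set: T] f -> measurable_fun [set: T] g -> 0 <= t ->
  (Lnorm mu t%:E^-1 (EFin \o (f \* g)%R) <=
   Lnorm mu +oo (EFin \o f) * Lnorm mu t%:E^-1 (EFin \o g))%E.
Proof.
move=> mf mg; rewrite le0r => /predU1P[->|t0].
  rewrite inve0; apply: Lnormy_le; first by rewrite mule_ge0 ?Lnorm_ge0.
  have := Lnormy_ae_ge f; have := Lnormy_ae_ge g.
  apply: filterS2 => x gx fx /=.
  by rewrite normrM EFinM lee_pmul.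
have LE (h : T -> R) : (Lnorm mu t^-1%:E (EFin \o h) =
    (\int[mu]_x `|(EFin \o h) x| `^ t^-1) `^ t)%E by rewrite unlock invrK.
rewrite inver gt_eqF// !LE.
set F := Lnorm _ _ _; have F0 : (0 <= F)%E by exact: Lnorm_ge0.
have mp (h : T -> R) : measurable_fun [set: T] h ->
    measurable_fun [set: T] (fun x => `|(EFin \o h) x| `^ t^-1)%E.
  move=> mh; apply: (@measurableT_comp _ _ _ _ _ _ (fun x => x `^ t^-1)%E) => //.
    exact: measurable_poweR.
  by apply: measurableT_comp => //; exact/measurable_EFinP.
rewrite -[F]poweRe1// -(@mulVf _ t) ?gt_eqF// poweRrM -poweRM; last 2 first.
- exact: poweR_ge0.
- by apply: integral_ge0 => x _; exact: poweR_ge0.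
apply: gt0_ler_poweR; first exact: ltW.
- by rewrite in_itv/= leey andbT integral_ge0// => x _; rewrite lee_fin powR_ge0.
- rewrite in_itv/= leey andbT mule_ge0// ?poweR_ge0//.
  by apply: integral_ge0 => x _; rewrite lee_fin powR_ge0.
rewrite -ge0_integralZl//; last 3 first.
- exact: mp.
- by move=> x _; exact: poweR_ge0.
- exact: poweR_ge0.
apply: ae_ge0_le_integral => //.
- by move=> x _; exact: poweR_ge0.
- by apply: mp; exact: measurable_funM.
- by move=> x _; rewrite mule_ge0// poweR_ge0.
- by apply: emeasurable_funM => //; exact: mp.
apply: filterS (Lnormy_ae_ge f) => x fx _.
have -> : (`|(EFin \o (f \* g)%R) x| = `|f x|%:E * `|g x|%:E)%E.
  by rewrite /= normrM.
rewrite poweRM// lee_pmul ?poweR_ge0//.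
apply: gt0_ler_poweR => //; rewrite ?invr_ge0 ?(ltW t0)// in_itv/= leey andbT//.
Qed.

(** When both exponents are finite, this is the conjugate-exponent inequality
    applied to powers of the functions.  The power makes the exponents conjugate
    even where some of them are below 1. *)
Lemma hoelder_Lnorm s t f g :
  measurable_fun [set: T] f -> measurable_fun [set: T] g -> 0 <= s -> 0 <= t ->
  (Lnorm mu (s + t)%:E^-1 (EFin \o (f \* g)%R) <=
   Lnorm mu s%:E^-1 (EFin \o f) * Lnorm mu t%:E^-1 (EFin \o g))%E.
Proof.
move=> mf mg; rewrite le0r => /predU1P[->|s0].
  by move=> t0; rewrite add0r inve0; exact: hoelder_Lnormy.
rewrite le0r => /predU1P[->|t0].
  rewrite addr0 inve0 muleC.
  have -> : f \* g = g \* f by apply/funext => x /=; rewrite mulrC.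
  by apply: hoelder_Lnormy => //; exact: ltW.
have st0 : 0 < s + t by rewrite addr_gt0.
pose q := (s + t)^-1; have q0 : 0 < q by rewrite invr_gt0.
pose pw (h : T -> R) x := `|h x| `^ q.
have mpw (h : T -> R) : measurable_fun [set: T] h -> measurable_fun [set: T] (pw h).
  move=> mh; apply: (@measurableT_comp _ _ _ _ _ _ (@powR R ^~ q)) => //.
  exact: measurableT_comp.
(* Passing from h to |h|^q multiplies all inverse exponents by s + t, which
   turns them into 1 and a pair of conjugate inverse exponents. *)
have scale (h : T -> R) w : 0 < w -> Lnorm mu w%:E^-1 (EFin \o h) =
    (Lnorm mu (w * q)^-1%:E (EFin \o pw h) `^ q^-1)%E.
  move=> w0; rewrite unlock inver gt_eqF// !invrK -poweRrM.
  rewrite -mulrA mulVf ?gt_eqF// mulr1; congr (_ `^ _)%E.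
  apply: eq_integral => x _ /=.
  rewrite (ger0_norm (powR_ge0 _ _)) -powRrM.
  by rewrite invfM mulrCA divff ?mulr1// gt_eqF.
rewrite !scale//.
rewrite -poweRM ?Lnorm_ge0// gt0_ler_poweR//.
- by rewrite invr_ge0 ltW.
- by rewrite in_itv/= leey Lnorm_ge0.
- by rewrite in_itv/= leey mule_ge0 ?Lnorm_ge0.
have -> : pw (f \* g) = pw f \* pw g.
  by apply/funext => x; rewrite /pw /= normrM powRM.
rewrite mulfV ?gt_eqF// invr1.
apply: hoelder; [exact: mpw|exact: mpw| | |].
- by rewrite invr_gt0 mulr_gt0.
- by rewrite invr_gt0 mulr_gt0.
- by rewrite !invrK -mulrDl mulfV// gt_eqF.
Qed.

(** Iterating the two-function inequality is possible because inverse exponents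
    add up; the empty product is the constant 1, of inverse exponent 0. *)
Lemma hoelder_Lnorm_prod (I : eqType) (s : seq I) (t : I -> R)
    (f : I -> T -> R) :
  (forall i, measurable_fun [set: T] (f i)) -> (forall i, 0 <= t i) ->
  (Lnorm mu (\sum_(i <- s) t i)%:E^-1
     (EFin \o (fun x => (\prod_(i <- s) f i x)%R)) <=
   \prod_(i <- s) Lnorm mu (t i)%:E^-1 (EFin \o f i))%E.
Proof.
move=> mf t0; elim: s => [|i s ih].
  rewrite !big_nil inve0; apply: Lnormy_le => //.
  by apply: nearW => x /=; rewrite big_nil normr1.
rewrite !big_cons.
have -> : (fun x => (\prod_(j <- i :: s) f j x)%R) =
    f i \* (fun x => (\prod_(j <- s) f j x)%R).
  by apply/funext => x; rewrite big_cons.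
apply: le_trans (hoelder_Lnorm _ _ _ _) _ => //.
- exact: measurable_prod.
- exact: sumr_ge0.
- by rewrite lee_pmul// Lnorm_ge0.
Qed.

End hoelder_products.

(** * Volumes of Euclidean balls *)

Section euclidean_balls.
Set Implicit Arguments.
Unset Strict Implicit.
Context (R : realType).

(** Cubes are open and centered, to match Euclidean balls; they live on tuples
    with the Borel structure, where the measure is a product. *)
Definition cube n (x : n.-tuple R) (d : R) :
    set (n.-tuple (measurableTypeR R)) :=
  [set y | forall i, `|tnth x i - tnth y i| < d].

Lemma measurable_cube n (x : n.-tuple R) d : measurable (cube x d).
Proof.
have -> : cube x d = \bigcap_(i in [set: 'I_n])
    ((fun y : n.-tuple (measurableTypeR R) => tnth y i) @^-1`
       [set z : measurableTypeR R | `|tnth x i - z| < d]).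
  by apply/seteqP; split=> [y h i _|y h i]; exact: h.
apply: fin_bigcap_measurable => // i _.
rewrite -[X in measurable X]setTI.
apply: (@measurable_tnth _ (measurableTypeR R)) => //.
have -> : [set z : measurableTypeR R | `|tnth x i - z| < d] =
    ([set` `]tnth x i - d, tnth x i + d[%R] : set R).
  by apply/seteqP; split=> z /=; rewrite in_itv/= ltr_distlC.
exact: measurable_itv.
Qed.

(** The cube in dimension [n + 1] is the product of an interval of length
    [2 * d] and the cube in dimension [n]. *)
Lemma borel_lebesgue_cube n (x : n.-tuple R) d : 0 <= d ->
  borel_lebesgue R n (cube x d) = ((2 * d) ^+ n)%:E.
Proof.
move=> d0; elim: n x => [|n ih] x.
  rewrite /= diracE expr0 mem_set//; by case.
rewrite /= /cons_measure /pushforward.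
have -> : cons_pair @^-1` cube x d =
    ([set` `]thead x - d, thead x + d[%R] : set (measurableTypeR R)) `*`
    cube [tuple of behead x] d.
  have bx j : tnth [tuple of behead x] j = tnth x (lift ord0 j).
    by rewrite [in RHS](tuple_eta x) tnthS.
  apply/seteqP; split=> -[a y] /=.
    move=> h; split.
      by have := h ord0; rewrite tnth0 in_itv/= ltr_distlC.
    move=> i; have := h (lift ord0 i).
    by rewrite tnthS bx.
  rewrite in_itv/= -ltr_distlC => -[ad h] i.
  case: (unliftP ord0 i) => [j|] ->; first by rewrite tnthS -bx; exact: h.
  by rewrite tnth0.
rewrite product_measure2E//=; last exact: measurable_cube.
rewrite ih lebesgue_measure_itv/= lte_fin.
rewrite exprS EFinM; congr (_ * _)%E.
case: ltP => xd; last by congr EFin; lra.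
by rewrite -EFinB; congr EFin; lra.
Qed.

Lemma measurable_sum_sq n (x : Rn R n) :
  measurable_fun [set: n.-tuple (measurableTypeR R)]
    (fun y => \sum_(i < n) (tnth x i - tnth y i) ^+ 2).
Proof.
apply: measurable_sum => i; apply: measurable_funX; apply: measurable_funB => //.
exact: measurable_tnth.
Qed.

Lemma measurable_eucl_dist n (x : Rn R n) :
  measurable_fun [set: Rn R n] (eucl_dist x).
Proof.
suff mf : measurable_fun [set: n.-tuple (measurableTypeR R)]
    (eucl_dist x : n.-tuple (measurableTypeR R) -> R).
  (* Borel sets are Lebesgue measurable *)
  move=> _ Y mY; apply: caratheodory_measurable_mu_ext.
  exact: mf.
apply: (@measurableT_comp _ _ _ _ _ _ (@Num.sqrt R)).
  by apply: continuous_measurable_fun; exact: sqrt_continuous.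
exact: measurable_sum_sq.
Qed.

Lemma measurable_eball n (x : Rn R n) r : measurable (eball x r).
Proof.
have := @measurable_eucl_dist n x measurableT [set` `]-oo, r[%R] (measurable_itv _).
rewrite setTI; congr (measurable _).
Qed.

Lemma leb_cube n (x : Rn R n) d : 0 <= d ->
  leb R n (cube x d) = ((2 * d) ^+ n)%:E.
Proof.
move=> d0; rewrite -(borel_lebesgue_cube x d0).
exact: (measurable_mu_extE (borel_lebesgue R n) (measurable_cube x d)).
Qed.

Lemma eball_cube n (x : Rn R n) r : eball x r `<=` cube x r.
Proof.
move=> y; rewrite /eball/= => xy i; apply: le_lt_trans xy; rewrite -sqrtr_sqr ler_wsqrtr//.
rewrite (bigD1 i)//= lerDl sumr_ge0// => j _; exact: sqr_ge0.
Qed.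

Lemma cube_eball n (x : Rn R n) r : (0 < n)%N -> 0 < r ->
  cube x (r / n%:R) `<=` eball x r.
Proof.
move=> n0 r0 y xy; rewrite /eball /=.
have n0' : 0 < n%:R :> R by rewrite ltr0n.
rewrite -[ltRHS]ger0_norm ?ltW// -sqrtr_sqr ltr_sqrt ?exprn_gt0//.
apply: (@lt_le_trans _ _ (\sum_(i < n) (r / n%:R) ^+ 2)).
  apply: ltr_sum; first by apply/hasP; exists (Ordinal n0); rewrite ?mem_index_enum.
  move=> i _; rewrite -[X in X < _]real_normK ?num_real//.
  by rewrite ltr_pXn2r ?nnegrE// divr_ge0// ltW.
rewrite sumr_const card_ord -[leLHS]mulr_natr expr_div_n -mulrA.
rewrite ler_piMr ?sqr_ge0// [n%:R ^+ 2]expr2 invfM -mulrA mulVf ?gt_eqF// mulr1.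
by rewrite invf_le1// ler1n.
Qed.

(** The ball contains the cube of half-side [r / n].  Since [vol] sends an
    infinite measure to 0, the proof also needs the ball to have finite
    measure; for that it is enclosed in the cube of half-side [r]. *)
Lemma vol_eball_ge n (x : Rn R n) r : (0 < n)%N -> 0 < r ->
  (2 * (r / n%:R)) ^+ n <= vol (eball x r).
Proof.
move=> n0 r0; have rn0 : 0 <= r / n%:R by rewrite divr_ge0// ltW.
have up : (leb R n (eball x r) <= ((2 * r) ^+ n)%:E)%E.
  rewrite -(leb_cube x (ltW r0)); apply: le_measure; rewrite ?inE.
  - exact: measurable_eball.
  - by apply: caratheodory_measurable_mu_ext; exact: measurable_cube.
  - exact: eball_cube.
rewrite /vol -lee_fin fineK; last first.
  by rewrite ge0_fin_numE ?measure_ge0// (le_lt_trans up) ?ltry.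
rewrite -(leb_cube x rn0); apply: le_measure; rewrite ?inE.
- by apply: caratheodory_measurable_mu_ext; exact: measurable_cube.
- exact: measurable_eball.
- exact: cube_eball.
Qed.

Lemma vol_eball_gt0 n (x : Rn R n) r : (0 < n)%N -> 0 < r ->
  0 < vol (eball x r).
Proof.
move=> n0 r0; apply: lt_le_trans (vol_eball_ge x n0 r0).
by rewrite exprn_gt0// mulr_gt0// divr_gt0// ltr0n.
Qed.

(** The radius is controlled by the [n]-th root of the volume, uniformly in the
    center: this makes the denominators in the class H_m comparable on the ball
    to a power of the volume.  The constant is not sharp. *)
Lemma radius_le_vol n (x : Rn R n) r : (0 < n)%N -> 0 < r ->
  r <= n%:R / 2 * vol (eball x r) `^ n%:R^-1.
Proof.
move=> n0 r0; have n0' : 0 < n%:R :> R by rewrite ltr0n.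
have a0 : 0 <= 2 * (r / n%:R) by rewrite mulr_ge0// divr_ge0// ltW.
rewrite [leLHS](_ : r = n%:R / 2 * (2 * (r / n%:R))); last first.
  by field; rewrite gt_eqF.
rewrite ler_pM2l ?divr_gt0//.
rewrite [leLHS](_ : _ = ((2 * (r / n%:R)) ^+ n) `^ n%:R^-1); last first.
  by rewrite -powR_mulrn// -powRrM divff ?gt_eqF// powRr1.
apply: ge0_ler_powR; rewrite ?nnegrE ?invr_ge0 ?exprn_ge0//.
- exact/ltW/vol_eball_gt0.
- exact: vol_eball_ge.
Qed.

End euclidean_balls.

(** * Arithmetic of exponents *)

Section exponents.
Set Implicit Arguments.
Unset Strict Implicit.
Context (R : realType).
Implicit Types p : \bar R.

Lemma inve_ge1 p : (1 <= p)%E -> 0 <= fine p^-1 <= 1 /\ (fine p^-1)%:E = p^-1%E.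
Proof.
case: p => [r| |]//=; last by rewrite invey /= lexx ler01.
rewrite lee_fin => r1; have r0 : 0 < r by rewrite (lt_le_trans ltr01).
rewrite inver gt_eqF//=; split=> //.
by rewrite invr_ge0 ltW//= invf_le1.
Qed.

Lemma hoelder_conjugate_inv p : (1 <= p)%E -> p != 1%E ->
  fine p^-1 < 1 /\ fine (hoelder_conjugate p) = (1 - fine p^-1)^-1.
Proof.
case: p => [r| |]//; last by rewrite hoelder_conjugatey invey /= subr0 invr1.
rewrite lee_fin eqe => r1 rn1.
have {r1 rn1}r1 : 1 < r by rewrite lt_neqAle eq_sym rn1.
have r0 : 0 < r by rewrite (lt_trans ltr01).
have r10 : 0 < r - 1 by rewrite subr_gt0.
rewrite inver gt_eqF//= invf_lt1//; split=> //.
rewrite /hoelder_conjugate /= eqe gt_eqF// -EFinB inver gt_eqF//=.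
by field; rewrite !gt_eqF.
Qed.

(** The condition [rh_exponent > 1] excludes the degenerate values of [p]: for
    [p = +oo] the exponent is [1 / m], and for [p = 1 / m] it is 0.  In the
    remaining case its inverse is [m - 1 / p], the sum of the inverses of the
    exponents conjugate to the [p_ i]. *)
Lemma rh_exponent_inv (I : finType) (p_ : I -> \bar R) p :
  (forall i, (1 <= p_ i)%E) -> (p^-1 = \sum_i (p_ i)^-1)%E ->
  1 < rh_exponent #|I| p ->
  (rh_exponent #|I| p)^-1 = \sum_i (1 - fine (p_ i)^-1) /\
  (p^-1 = (\sum_i fine (p_ i)^-1)%:E)%E.
Proof.
move=> p_1 pE a1; set S := (X in _ /\ (_ = X%:E)%E).
have {}pE : (p^-1 = S%:E)%E.
  by rewrite pE /S -sumEFin; apply: eq_bigr => i _; rewrite (inve_ge1 (p_1 i)).2.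
rewrite sumrB sumr_const -/S; split=> //.
move: p pE a1 => [r| |]//=.
- rewrite inver; case: ifPn => // r0 [<-] a1.
  by rewrite invf_div mulrBl mul1r mulfK.
- rewrite ltNge; case: #|I| => [|k]; first by rewrite invr0 ler01.
  by rewrite invf_le1 ?ltr0n// ler1n.
Qed.

Lemma prod_powR (I : Type) (s : seq I) (a : R) (k : I -> R) : 0 < a ->
  \prod_(i <- s) a `^ k i = a `^ (\sum_(i <- s) k i).
Proof.
move=> a0; elim: s => [|i s ih]; first by rewrite !big_nil powRr0.
by rewrite !big_cons ih powRD // (gt_eqF a0) implybT.
Qed.

End exponents.

(** * Products of inverses against a bounded denominator *)

Section scaled_inverses.
Set Implicit Arguments.
Unset Strict Implicit.
Context d (T : measurableType d) (R : realType) (mu : {measure set T -> \bar R}).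
Implicit Types (f v b : T -> R) (k : R).

Lemma measurable_fun_powR f k :
  measurable_fun [set: T] f -> measurable_fun [set: T] (fun y => f y `^ k : R).
Proof. exact: (@measurableT_comp _ _ _ _ _ _ (@powR R ^~ k)). Qed.

Lemma measurable_funV f :
  measurable_fun [set: T] f -> measurable_fun [set: T] (fun y => (f y)^-1 : R).
Proof.
move=> mf.
(* a form that uses only powers of nonnegative numbers; it is correct at
   zeros of f because the inverse of 0 is 0 *)
have -> : (fun y => (f y)^-1) = f \* (fun y => (f y ^+ 2) `^ (-1)).
  apply/funext => y /=; rewrite powR_inv1 ?sqr_ge0//.
  have [->|fy0] := eqVneq (f y) 0; first by rewrite invr0 mul0r.
  by rewrite expr2 invfM mulrA divff// mul1r.
by apply: measurable_funM => //; exact/measurable_fun_powR/measurable_funX.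
Qed.

(** The function whose norm is the factor of [v] in the class H_m; [b] stands
    for the denominator before it is raised to the power [k]. *)
Definition scaled_inv k v b y : R := (v y)^-1 / b y `^ k.

Lemma measurable_scaled_inv k v b :
  measurable_fun [set: T] v -> measurable_fun [set: T] b ->
  measurable_fun [set: T] (scaled_inv k v b).
Proof.
move=> mv mb; apply: measurable_funM; apply: measurable_funV => //.
exact: measurable_fun_powR.
Qed.

(** The two integrands may differ where [v] is not positive, since real powers
    of negative numbers are not multiplicative. *)
Lemma Lnorm_scaled_inv k q v b :
  measurable_fun [set: T] v -> measurable_fun [set: T] b ->
  {ae mu, forall y, 0 < v y} -> (forall y, 0 < b y) ->
  ((\int[mu]_y (v y `^ (- q) / b y `^ (k * q))%:E) `^ q^-1)%E =
  Lnorm mu q%:E (EFin \o scaled_inv k v b).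
Proof.
move=> mv mb v0 b0; rewrite unlock; congr (_ `^ _)%E.
apply: ge0_ae_eq_integral => //.
- apply/measurable_EFinP; apply: measurable_funM; first exact: measurable_fun_powR.
  by apply: measurable_funV; exact: measurable_fun_powR.
- apply/measurable_EFinP/measurable_fun_powR/measurableT_comp => //.
  exact: measurable_scaled_inv.
- by move=> y _; rewrite lee_fin divr_ge0 ?powR_ge0.
- by move=> y _; exact: poweR_ge0.
apply: filterS v0 => y vy _ /=; congr EFin.
rewrite /scaled_inv ger0_norm; last by rewrite divr_ge0 ?powR_ge0 ?invr_ge0 ?ltW.
rewrite powRM ?invr_ge0 ?powR_ge0 ?(ltW vy)//.
rewrite -[(v y)^-1]powR_inv1 ?(ltW vy)// -[(b y `^ k)^-1]powRN.
by rewrite -!powRrM mulN1r mulNr [b y `^ (- _)]powRN.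
Qed.

(** Each [(v i)^-1] is [scaled_inv] times [b ^ k i], and [b <= D]. *)
Lemma prodV_scaled_le m (v : 'I_m -> T -> R) (b : T -> R) (k : 'I_m -> R)
    (D : R) (y : T) :
  (forall i, 0 < v i y) -> 0 < b y -> b y <= D -> (forall i, 0 <= k i) ->
  \prod_(i < m) (v i y)^-1 <=
  D `^ (\sum_(i < m) k i) * `|\prod_(i < m) scaled_inv (k i) (v i) b y|.
Proof.
move=> v0 b0 bD k0; have D0 : 0 < D by exact: lt_le_trans bD.
rewrite -(prod_powR _ _ D0) normr_prod -big_split/=; apply: ler_prod => i _.
rewrite invr_ge0 (ltW (v0 i))/= ger0_norm; last first.
  by rewrite divr_ge0 ?powR_ge0 ?invr_ge0 ?ltW.
rewrite mulrCA ler_peMr ?invr_ge0 ?(ltW (v0 i))// ler_pdivlMr ?powR_gt0// mul1r.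
by rewrite ge0_ler_powR ?nnegrE ?(ltW b0) ?(ltW D0).
Qed.

(** The core estimate: on [B] the denominators are bounded by powers of [D], so
    they can be reinserted at the cost of one power of [D]; Hoelder's
    inequality is then applied on the whole space, to the very functions whose
    norms occur in the class H_m. *)
Lemma local_hoelder m (v : 'I_m -> T -> R) (b : T -> R) (k t : 'I_m -> R)
    (a D : R) (B : set T) : measurable B ->
  (forall i, measurable_fun [set: T] (v i)) -> measurable_fun [set: T] b ->
  {ae mu, forall y i, 0 < v i y} -> (forall y, 0 < b y) ->
  (forall y, B y -> b y <= D) ->
  (forall i, 0 <= k i) -> (forall i, 0 <= t i) ->
  0 < a -> a^-1 = \sum_(i < m) t i ->
  ((\int[mu]_(y in B) ((\prod_(i < m) (v i y)^-1) `^ a)%:E) `^ a^-1 <=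
   (D `^ (\sum_(i < m) k i))%:E *
   \prod_(i < m) Lnorm mu (t i)%:E^-1 (EFin \o scaled_inv (k i) (v i) b))%E.
Proof.
move=> mB mv mb v0 b0 bD k0 t0 a0 at_.
set E := D `^ _; have E0 : 0 <= E by exact: powR_ge0.
pose G y := \prod_(i < m) scaled_inv (k i) (v i) b y.
have mG : measurable_fun [set: T] G.
  by apply: measurable_prod => i _; exact: measurable_scaled_inv.
have mGa : measurable_fun [set: T] (fun y => ((E * `|G y|) `^ a)%:E).
  apply/measurable_EFinP/measurable_fun_powR.
  by apply: measurable_funM => //; exact: measurableT_comp.
have normG : Lnorm mu a%:E (EFin \o (fun y => E * `|G y|)) =
    (E%:E * Lnorm mu a%:E (EFin \o G))%E.
  rewrite unlock -[E%:E]poweRe1 ?lee_fin// -(@mulfV _ a) ?gt_eqF// poweRrM.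
  rewrite -poweRM ?poweR_ge0//; last by apply: integral_ge0 => y _; exact: poweR_ge0.
  congr (_ `^ _)%E; rewrite -ge0_integralZl ?poweR_ge0//.
  - apply: eq_integral => y _ /=.
    by rewrite normrM (ger0_norm E0) normr_id powRM// EFinM.
  - by apply/measurable_EFinP/measurable_fun_powR; exact: measurableT_comp.
  - by move=> y _; exact: poweR_ge0.
have aE : (a^-1%:E^-1 = a%:E)%E by rewrite inver gt_eqF ?invr_gt0// invrK.
apply: (@le_trans _ _ (E%:E * Lnorm mu a%:E (EFin \o G))%E); last first.
  rewrite lee_wpmul2l ?lee_fin// -aE at_; apply: hoelder_Lnorm_prod => // i.
  exact: measurable_scaled_inv.
rewrite -normG Lnorm.unlock; apply: gt0_ler_poweR.
- by rewrite invr_ge0 ltW.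
- by rewrite in_itv/= leey andbT integral_ge0// => y _; rewrite lee_fin powR_ge0.
- by rewrite in_itv/= leey andbT integral_ge0// => y _; rewrite lee_fin powR_ge0.
rewrite [leRHS](_ : _ = \int[mu]_y ((E * `|G y|) `^ a)%:E)%E; last first.
  by apply: eq_integral => y _ /=; rewrite normrM (ger0_norm E0) normr_id.
apply: (@le_trans _ _ (\int[mu]_(y in B) ((E * `|G y|) `^ a)%:E)%E); last first.
  by apply: ge0_subset_integral => // y _; rewrite lee_fin powR_ge0.
apply: ae_ge0_le_integral => //.
- by move=> y _; rewrite lee_fin powR_ge0.
- apply/measurable_funTS/measurable_EFinP/measurable_fun_powR.
  by apply: measurable_prod => i _; exact: measurable_funV.
- by move=> y _; rewrite lee_fin powR_ge0.
- exact: measurable_funTS.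
apply: filterS v0 => y vy By; rewrite lee_fin ge0_ler_powR ?nnegrE//.
- exact: ltW.
- by apply: prodr_ge0 => i _; rewrite invr_ge0 ltW.
- by rewrite mulr_ge0.
- by apply: prodV_scaled_le => //; exact: bD.
Qed.

End scaled_inverses.

(** * Weights and the factors of the class H_m on a ball *)

Section weights_on_balls.
Set Implicit Arguments.
Unset Strict Implicit.
Context (R : realType) (n : nat).
Implicit Types (x y : Rn R n) (r k a : R) (v : Rn R n -> R).

Definition ball_scale x r y : R :=
  vol (eball x r) `^ n%:R^-1 + eucl_dist x y.

Lemma ball_scale_gt0 x r y : (0 < n)%N -> 0 < r -> 0 < ball_scale x r y.
Proof.
move=> n0 r0; rewrite /ball_scale ltr_wpDr ?sqrtr_ge0//.
exact/powR_gt0/vol_eball_gt0.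
Qed.

Lemma ball_scale_le x r y : (0 < n)%N -> 0 < r -> eball x r y ->
  ball_scale x r y <= (1 + n%:R / 2) * vol (eball x r) `^ n%:R^-1.
Proof.
move=> n0 r0 xy; rewrite mulrDl mul1r lerD2l.
exact: le_trans (ltW xy) (radius_le_vol x n0 r0).
Qed.

Lemma measurable_ball_scale x r : measurable_fun [set: Rn R n] (ball_scale x r).
Proof.
exact: (measurable_funD (measurable_cst _) (@measurable_eucl_dist R n x)).
Qed.

(** The case distinction in [Hfactor] disappears when the exponent is written as
    the inverse of [1 - 1 / p], which is 0 for [p = 1]. *)
Lemma Hfactor_Lnorm p k v x r : (0 < n)%N -> 0 < r -> (1 <= p)%E -> weight v ->
  Hfactor p k v x r =
  Lnorm (leb R n) (1 - fine p^-1)%:E^-1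
    (EFin \o scaled_inv k v (ball_scale x r)).
Proof.
move=> n0 r0 p1 [[mv _] v0]; rewrite /Hfactor.
case: ifPn => [/eqP ->|pn1].
  by rewrite inve1 /= subrr inve0.
have [tp qE] := hoelder_conjugate_inv p1 pn1.
have t0 : 0 < 1 - fine p^-1 by rewrite subr_gt0.
rewrite qE inver (gt_eqF t0).
exact: (Lnorm_scaled_inv _ _ mv (measurable_ball_scale x r) v0
  (fun y => ball_scale_gt0 x y n0 r0)).
Qed.

Lemma ae_all_weights m (v : 'I_m -> Rn R n -> R) : (forall i, weight (v i)) ->
  {ae leb R n, forall y i, 0 < v i y}.
Proof.
move=> wv; have : forall i, {ae leb R n, forall y, 0 < v i y}.
  by move=> i; exact: (wv i).2.
by move=> /filter_forall.
Qed.

Lemma weight_prodV m (v : 'I_m -> Rn R n -> R) : (forall i, weight (v i)) ->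
  loc_integrable (fun y => (\prod_(i < m) v i y)^-1) ->
  weight (fun y => \prod_(i < m) (v i y)^-1).
Proof.
move=> wv; have -> : (fun y => (\prod_(i < m) v i y)^-1) =
    (fun y => \prod_(i < m) (v i y)^-1).
  by apply/funext => y; rewrite prodfV.
move=> lv; split; first exact: lv.
apply: filterS (ae_all_weights wv) => y vy.
by apply: prodr_gt0 => i _; rewrite invr_gt0.
Qed.

(** [local_hoelder] on a ball, where [ball_scale] is at most a constant times
    the [n]-th root of the volume.  The power of the volume on the right
    collects this bound and the factor [1 / |B|] of the average. *)
Lemma average_prodV_le m (v : 'I_m -> Rn R n -> R) (k t : 'I_m -> R) a x r :
    (0 < n)%N -> 0 < r -> (forall i, weight (v i)) ->
    (forall i, 0 <= k i) -> (forall i, 0 <= t i) ->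
    0 < a -> a^-1 = \sum_(i < m) t i ->
  (average (eball x r) (fun y => (\prod_(i < m) (v i y)^-1) `^ a)%R `^ a^-1 <=
   ((1 + n%:R / 2) `^ (\sum_(i < m) k i))%:E *
   ((vol (eball x r) `^ ((\sum_(i < m) k i) / n%:R - a^-1))%:E *
   \prod_(i < m) Lnorm (leb R n) (t i)%:E^-1
      (EFin \o scaled_inv (k i) (v i) (ball_scale x r))))%E.
Proof.
move=> n0 r0 wv k0 t0 a0 at_.
set B := eball x r; set K := \sum_(i < m) k i.
set c := 1 + n%:R / 2; have c0 : 0 < c by rewrite addr_gt0// divr_gt0// ltr0n.
have V0 : 0 < vol B by exact: vol_eball_gt0.
have := local_hoelder (measurable_eball x r) (fun i => (wv i).1.1)
  (measurable_ball_scale x r) (ae_all_weights wv)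
  (fun y => ball_scale_gt0 x y n0 r0) (fun y => @ball_scale_le x r y n0 r0)
  k0 t0 a0 at_.
rewrite -/B -/K -/c; set N := (\prod_(i < m) _)%E; set J := integral _ _ _ => JN.
rewrite /average poweRM; last 2 first.
- by rewrite lee_fin invr_ge0 ltW.
- by apply: integral_ge0 => y _; rewrite lee_fin powR_ge0.
rewrite poweR_EFin.
apply: (le_trans (lee_wpmul2l _ JN)); first by rewrite lee_fin powR_ge0.
rewrite !muleA -!EFinM le_eqVlt; apply/orP; left; apply/eqP; congr (_%:E * _)%E.
rewrite powRM ?(ltW c0) ?powR_ge0// -[(vol B)^-1]powR_inv1 ?(ltW V0)//.
rewrite -!powRrM mulN1r [n%:R^-1 * K]mulrC powRD; last by rewrite (gt_eqF V0) implybT.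
ring.
Qed.

End weights_on_balls.

(** * The reverse Hoelder inequality *)

Theorem corollary1p4 (R : realType) (m n : nat) (gamma : R)
    (hgamma : 0 < gamma < m%:R * n%:R)
    (p_ : 'I_m -> \bar R) (hp_ : forall i, (1 <= p_ i)%E)
    (p : \bar R) (hp : (p^-1 = \sum_(i < m) (p_ i)^-1)%E)
    (delta : R) (hdelta : delta = gamma - fine (n%:R%:E / p)%E)
    (v : 'I_m -> Rn R n -> R) (hv : forall i, weight (v i))
    (hH : Hclass p_ gamma delta v)
    (alpha : R) (halpha : alpha = rh_exponent m p) (alpha_gt1 : 1 < alpha) :
  reverse_hoelder alpha (fun y => \prod_(i < m) (v i y)^-1).
Proof.
case: hH => _ locV [g [g0n gsum [C C0 HC]]].
have {hgamma} mn0 : (0 < m * n)%N.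
  by have /andP[g0 gmn] := hgamma; rewrite -(ltr0n R) natrM (lt_trans g0).
have /andP[m0 n0] : (0 < m)%N && (0 < n)%N by rewrite -muln_gt0.
have m0' : 0 < m%:R :> R by rewrite ltr0n.
have n0' : 0 < n%:R :> R by rewrite ltr0n.
have [aE pE] : alpha^-1 = \sum_(i < m) (1 - fine (p_ i)^-1) /\
    (p^-1 = (\sum_(i < m) fine (p_ i)^-1)%:E)%E.
  rewrite halpha -[m in rh_exponent m _]card_ord; apply: rh_exponent_inv => //.
  by rewrite card_ord -halpha.
pose k i := n%:R - g i + m%:R^-1.
have k0 i : 0 <= k i.
  by rewrite addr_ge0 ?invr_ge0 ?(ltW m0')// subr_ge0 ltW//; case/andP: (g0n i).
have a0 : 0 < alpha by rewrite (lt_trans ltr01).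
have t0 i : 0 <= 1 - fine (p_ i)^-1.
  by rewrite subr_ge0; have [/andP[]] := inve_ge1 (hp_ i).
have kE : \sum_(i < m) k i = m%:R * n%:R - gamma + 1.
  rewrite big_split/= sumrB gsum !sumr_const card_ord.
  rewrite -(mulr_natl n%:R m) -(mulr_natl m%:R^-1 m).
  by rewrite divff// gt_eqF.
have deltaE : delta = gamma - n%:R * \sum_(i < m) fine (p_ i)^-1.
  by rewrite hdelta pE.
(* the scaling identity: the powers of the volume on both sides agree *)
have expE : (\sum_(i < m) k i) / n%:R - alpha^-1 = (1 - delta) / n%:R.
  rewrite kE aE sumrB sumr_const card_ord deltaE.
  by field; rewrite gt_eqF.
split; first exact: weight_prodV.
exists ((1 + n%:R / 2) `^ (\sum_(i < m) k i) * C).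
  by rewrite mulr_gt0// powR_gt0// addr_gt0// divr_gt0.
move=> x r r0.
apply: le_trans (average_prodV_le x n0 r0 hv k0 t0 a0 aE) _.
rewrite EFinM -muleA lee_wpmul2l ?lee_fin ?powR_ge0// expE.
apply: le_trans (HC x r r0).
rewrite lee_wpmul2l ?lee_fin ?powR_ge0//.
under [leRHS]eq_bigr do rewrite Hfactor_Lnorm//.
by [].
Qed.
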